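(* Let $G = \langle S \mid T \rangle$ be a group, where $S \subseteq G$ is a generating set and $T$ is a set of relators (words in the elements of $S$ and their formal inverses, regarded as elements of the free group on $S$). Let $F_S$ be the free group on $S$ and let $\phi\colon F_S \to G$ be the canonical surjective homomorphism of $F_S$ onto $G$. Let $R$ be a commutative unital ring and let $f\colon S \to RG$ be a map. Then: \begin{enumerate} \item[(i)] $f$ can be uniquely extended to a map $f^*\colon F_S \to RG$ such that $$f^*(uv) = f^*(u)\phi(v) + \phi(u)f^*(v) \quad \text{for all } u, v \in F_S;$$ \item[(ii)] the map $f\colon S\to RG$ can be extended to an $R$-derivation of $RG$ if and only if $f^*(t) = 0$ for all $t \in T$; \item[(iii)] if $f$ can be extended to an $R$-derivation of $RG$, then this extension is unique. \end{enumerate}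
   Context: $RG$ denotes the group ring: formal finitely supported sums $\sum_{g\in G} a_g g$ with $a_g\in R$, with componentwise addition and multiplication $(\sum a_g g)(\sum b_h h)=\sum a_g b_h gh$. $G=\langle S\mid T\rangle$ means that $\phi$ is surjective with kernel the normal closure of $T$ in $F_S$; $\phi$ restricts to the identity on $S$, where $S$ is viewed both as a subset of $F_S$ and as a subset of $G$. Elements of $G$ are viewed as elements of $RG$, so products such as $f^*(u)\phi(v)$ are taken in $RG$. A derivation of a ring $A$ is a map $d\colon A\to A$ with $d(a+b)=d(a)+d(b)$ and $d(ab)=d(a)b+a\,d(b)$ for all $a,b\in A$. A derivation $d$ of $RG$ is an $R$-derivation if $d(R)=\{0\}$. A derivation $d$ of $RG$ extends $f$ if $d(s)=f(s)$ for all $s\in S\subseteq G$. *)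

(* Defs.v *)
From HB Require Import structures.
From mathcomp Require Import all_boot ssralg finmap monalg.
From mathcomp Require Import boolp classical_sets.

Set Implicit Arguments.
Unset Strict Implicit.
Unset Printing Implicit Defensive.

Import GRing.Theory.

Local Open Scope classical_set_scope.
Local Open Scope ring_scope.

(* Free groups: an element is a reduced word in the letters (x, false),
   standing for x, and (x, true), standing for the formal inverse of x. *)

Section ReducedWords.
Variable X : choiceType.
Implicit Types (a b : X * bool) (u v w : seq (X * bool)).

Definition linv a : X * bool := (a.1, ~~ a.2).

Definition reduced w := sorted (fun a b => b != linv a) w.

Definition push a w :=
  if w is b :: w' then if b == linv a then w' else a :: w else [:: a].

Definition wmul u v := foldr push v u.

Definition winv w := rev [seq linv a | a <- w].

Lemma linvK : involutive linv.
Proof. by case=> x b; rewrite /linv /= negbK. Qed.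

Lemma reduced_behead a w : reduced (a :: w) -> reduced w.
Proof. by case: w => //= b w /andP[]. Qed.

Lemma reduced_push a w : reduced w -> reduced (push a w).
Proof.
case: w => //= b w rw; case: ifP => [_|/negbT neq].
  exact: reduced_behead rw.
by rewrite /= neq.
Qed.

Lemma reduced_wmul u v : reduced v -> reduced (wmul u v).
Proof. by move=> rv; elim: u => //= a u IHu; apply: reduced_push. Qed.

Lemma push_cons a w : reduced (a :: w) -> push a w = a :: w.
Proof. by case: w => //= b w /andP[/negbTE->]. Qed.

Lemma pushK a w : reduced w -> push (linv a) (push a w) = w.
Proof.
case: w => [|b w] /=; first by rewrite linvK eqxx.
case: ifP => [/eqP-> rw|_ _]; first by rewrite push_cons.
by rewrite /= linvK eqxx.
Qed.

Lemma wmul0 w : reduced w -> wmul w [::] = w.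
Proof.
elim: w => //= a w IHw rw.
by rewrite IHw ?push_cons //; apply: reduced_behead rw.
Qed.

Lemma wmul_push a w v :
  reduced w -> reduced v -> wmul (push a w) v = push a (wmul w v).
Proof.
case: w => //= b w rw rv; case: ifP => [/eqP->|_] //=.
by rewrite -[X in push X _]linvK pushK //; apply: reduced_wmul.
Qed.

Lemma wmulA u v w :
  reduced v -> reduced w -> wmul u (wmul v w) = wmul (wmul u v) w.
Proof.
move=> rv rw; elim: u => //= a u ->.
by rewrite wmul_push //; apply: reduced_wmul.
Qed.

Lemma wmulV w v : reduced v -> wmul (winv w) (wmul w v) = v.
Proof.
move=> rv; elim: w => //= a w IHw.
by rewrite /winv /= rev_cons /wmul foldr_rcons pushK //; apply: reduced_wmul.
Qed.

Lemma winvK : involutive winv.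
Proof. by move=> w; rewrite /winv map_rev revK (mapK linvK). Qed.

Lemma reduced_winv w : reduced w -> reduced (winv w).
Proof.
rewrite /winv /reduced rev_sorted sorted_map; apply: sub_sorted => a b /=.
by apply: contra => /eqP/(can_inj linvK)->; rewrite linvK.
Qed.

End ReducedWords.

Record freegroup (X : choiceType) := FreeGroup {
  fgword : seq (X * bool);
  fgword_reduced : reduced fgword
}.

HB.instance Definition _ X := [isSub for @fgword X].
HB.instance Definition _ X := [Choice of freegroup X by <:].

Section FreeGroup.
Variable X : choiceType.
Implicit Types u v w : freegroup X.

Definition fg_one := @FreeGroup X [::] isT.
Definition fg_mul u v := FreeGroup (reduced_wmul (fgword u) (fgword_reduced v)).
Definition fg_inv u := FreeGroup (reduced_winv (fgword_reduced u)).

Lemma fg_mulA : associative fg_mul.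
Proof. by move=> u v w; apply/val_inj; rewrite /= wmulA ?fgword_reduced. Qed.

Lemma fg_mul1g : left_id fg_one fg_mul.
Proof. by move=> u; apply/val_inj. Qed.

Lemma fg_mulg1 : right_id fg_one fg_mul.
Proof. by move=> u; apply/val_inj; rewrite /= wmul0 ?fgword_reduced. Qed.

Lemma fg_mulVg : left_inverse fg_one fg_inv fg_mul.
Proof.
move=> u; apply/val_inj; rewrite /= -[X in wmul _ X](wmul0 (fgword_reduced u)).
by rewrite wmulV.
Qed.

Lemma fg_mulgV : right_inverse fg_one fg_inv fg_mul.
Proof.
move=> u; rewrite -[X in fg_mul X _](_ : fg_inv (fg_inv u) = u) ?fg_mulVg //.
by apply/val_inj/winvK.
Qed.

HB.instance Definition _ := isGroup.Build (freegroup X)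
  fg_mulA fg_mul1g fg_mulg1 fg_mulVg fg_mulgV.

Definition fg_gen (x : X) : freegroup X := @FreeGroup X [:: (x, false)] isT.

End FreeGroup.

Section FreeGroupLift.
Variables (X : choiceType) (H : groupType) (h : X -> H).
Local Open Scope group_scope.

Definition letter_eval (a : X * bool) : H := if a.2 then (h a.1)^-1 else h a.1.

Definition fg_lift (w : freegroup X) : H := \prod_(a <- fgword w) letter_eval a.

Lemma letter_evalV a : letter_eval (linv a) = (letter_eval a)^-1.
Proof. by case: a => x [] /=; rewrite /letter_eval /= ?invgK. Qed.

Lemma fg_lift1 : fg_lift 1 = 1.
Proof. by rewrite /fg_lift big_nil. Qed.

Lemma fg_liftM : {morph fg_lift : u v / u * v}.
Proof.
move=> u v; rewrite /fg_lift /= /wmul.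
elim: (fgword u) => [|a w IHw] /=; first by rewrite big_nil mul1g.
rewrite big_cons -mulgA -{}IHw; case: (foldr _ _ w) => [|b w'] /=.
  by rewrite big_cons.
case: eqP => [->|_]; last by rewrite big_cons.
by rewrite big_cons letter_evalV mulVKg.
Qed.

HB.instance Definition _ := isUMagmaMorphism.Build (freegroup X) H fg_lift
  (fg_lift1, fg_liftM).

Lemma fg_lift_gen x : fg_lift (fg_gen x) = h x.
Proof. by rewrite /fg_lift big_seq1. Qed.

Lemma fg_lift_unique (k : freegroup X -> H) :
  {morph k : u v / u * v} -> (forall x, k (fg_gen x) = h x) -> k =1 fg_lift.
Proof.
move=> kM kgen; have k1 : k 1 = 1.
  by apply: (can_inj (mulKg (k 1))); rewrite -kM !mulg1.
case=> w; elim: w => [|a w IHw] rw.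
  by rewrite /fg_lift big_nil -k1; congr k; apply/val_inj.
pose l : freegroup X := @FreeGroup X [:: a] isT.
have rw' := reduced_behead rw.
have -> : FreeGroup rw = l * FreeGroup rw'.
  by apply/val_inj; rewrite /= push_cons.
have kl : k l = fg_lift l.
  rewrite /fg_lift big_seq1 {}/l; case: a {rw} => x [] /=; last exact: kgen.
  rewrite /letter_eval /= -kgen; apply: (can_inj (mulKg (k (fg_gen x)))).
  rewrite mulgV -kM -k1; congr k; apply/val_inj.
  by rewrite /= /linv /= eqxx.
by rewrite kM IHw kl fg_liftM.
Qed.

End FreeGroupLift.

Definition normal_subgroup (H : groupType) (N : set H) : Prop :=
  [/\ N 1%g,
      forall x y, N x -> N y -> N (x * y)%g,
      forall x, N x -> N (x^-1)%g
    & forall x y, N x -> N (x ^ y)%g].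

Definition normal_closure (H : groupType) (T : set H) : set H :=
  smallest (@normal_subgroup H) T.

(* The homomorphism F_S -> G restricting to the identity on S. *)
Definition can_hom (G : groupType) (S : set G) : freegroup S -> G :=
  fg_lift (fun s : S => val s).

Arguments can_hom {G} S w.

(* G = < S | T > *)
Definition presentation (G : groupType) (S : set G) (T : set (freegroup S)) :=
  (forall g : G, exists w, can_hom S w = g) /\
  [set w | can_hom S w = 1%g] = normal_closure T.

Arguments presentation {G} S T.

(* The group ring RG. The ring structure that monalg puts on {malg R[K]}
   requires the monoid K to have no nontrivial units, hence the alias. *)
Definition groupring (R : pzRingType) (G : groupType) := {malg R[G]}.

HB.instance Definition _ R G := GRing.Zmodule.on (groupring R G).

Section GroupRing.
Variables (R : pzRingType) (G : groupType).
Implicit Types (a b c : groupring R G) (g h : G).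
Local Open Scope fset_scope.

Definition gr_one : groupring R G := << 1 *g 1%g >>.

Definition gr_mul a b : groupring R G :=
  \sum_(g <- msupp a) \sum_(h <- msupp b) << a@_g * b@_h *g (g * h)%g >>.

Lemma gr_mulw (d1 d2 : {fset G}) a b :
  msupp a `<=` d1 -> msupp b `<=` d2 ->
  gr_mul a b = \sum_(g <- d1) \sum_(h <- d2) << a@_g * b@_h *g (g * h)%g >>.
Proof.
move=> le_d1 le_d2; rewrite /gr_mul (big_fset_incl _ le_d1) /=.
  apply/eq_bigr=> g _; apply/big_fset_incl => // h _ /mcoeff_outdom ->.
  by rewrite mulr0 monalgU0.
move=> g _ /mcoeff_outdom ag.
by rewrite big1 // => h _; rewrite ag mul0r monalgU0.
Qed.

Lemma gr_mulDl : left_distributive gr_mul +%R.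
Proof.
move=> a b c; rewrite (gr_mulw (msuppD_le a b) (fsubset_refl (msupp c))).
rewrite (gr_mulw (fsubsetUl (msupp a) (msupp b)) (fsubset_refl (msupp c))).
rewrite (gr_mulw (fsubsetUr (msupp a) (msupp b)) (fsubset_refl (msupp c))).
rewrite -big_split /=; apply/eq_bigr=> g _.
rewrite -big_split /=; apply/eq_bigr=> h _.
by rewrite mcoeffD mulrDl monalgUD.
Qed.

Lemma gr_mulDr : right_distributive gr_mul +%R.
Proof.
move=> c a b; rewrite (gr_mulw (fsubset_refl (msupp c)) (msuppD_le a b)).
rewrite (gr_mulw (fsubset_refl (msupp c)) (fsubsetUl (msupp a) (msupp b))).
rewrite (gr_mulw (fsubset_refl (msupp c)) (fsubsetUr (msupp a) (msupp b))).
rewrite -big_split /=; apply/eq_bigr=> g _.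
rewrite -big_split /=; apply/eq_bigr=> h _.
by rewrite mcoeffD mulrDr monalgUD.
Qed.

Lemma gr_mulUU (r s : R) g h :
  gr_mul << r *g g >> << s *g h >> = << r * s *g (g * h)%g >>.
Proof. by rewrite (gr_mulw msuppU_le msuppU_le) !big_seq_fset1 !mcoeffUU. Qed.

Lemma gr_mul0r : left_zero 0 gr_mul.
Proof. by move=> a; rewrite /gr_mul msupp0 big_seq_fset0. Qed.

Lemma gr_mulr0 : right_zero 0 gr_mul.
Proof.
by move=> a; rewrite /gr_mul msupp0 big1 // => g _; rewrite big_seq_fset0.
Qed.

Lemma gr_mul_suml (I : Type) (s : seq I) (F : I -> groupring R G) b :
  gr_mul (\sum_(i <- s) F i) b = \sum_(i <- s) gr_mul (F i) b.
Proof.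
exact: (big_morph (gr_mul^~ b) (fun _ _ => gr_mulDl _ _ _) (gr_mul0r _)).
Qed.

Lemma gr_mul_sumr (I : Type) (s : seq I) (F : I -> groupring R G) a :
  gr_mul a (\sum_(i <- s) F i) = \sum_(i <- s) gr_mul a (F i).
Proof.
exact: (big_morph (gr_mul a) (fun _ _ => gr_mulDr _ _ _) (gr_mulr0 _)).
Qed.

Lemma gr_mulEl a b :
  gr_mul a b = \sum_(g <- msupp a) gr_mul << a@_g *g g >> b.
Proof. by rewrite {1}[a]monalgE gr_mul_suml. Qed.

Lemma gr_mulEr a b :
  gr_mul a b = \sum_(h <- msupp b) gr_mul a << b@_h *g h >>.
Proof. by rewrite {1}[b]monalgE gr_mul_sumr. Qed.

Lemma gr_mulA : associative gr_mul.
Proof.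
move=> a b c; rewrite (gr_mulEl a (gr_mul b c)) (gr_mulEl a b) gr_mul_suml.
apply/eq_bigr=> g _; rewrite (gr_mulEl b c) (gr_mulEr _ b).
rewrite gr_mul_sumr gr_mul_suml; apply/eq_bigr=> h _.
rewrite (gr_mulEr _ c) gr_mul_sumr [RHS]gr_mulEr; apply/eq_bigr=> k _.
by rewrite !gr_mulUU mulrA mulgA.
Qed.

Lemma gr_mul1r : left_id gr_one gr_mul.
Proof.
move=> a; rewrite gr_mulEr [RHS]monalgE.
by apply/eq_bigr=> g _; rewrite gr_mulUU mul1r mul1g.
Qed.

Lemma gr_mulr1 : right_id gr_one gr_mul.
Proof.
move=> a; rewrite gr_mulEl [RHS]monalgE.
by apply/eq_bigr=> g _; rewrite gr_mulUU mulr1 mulg1.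
Qed.

HB.instance Definition _ := GRing.Zmodule_isPzRing.Build (groupring R G)
  gr_mulA gr_mul1r gr_mulr1 gr_mulDl gr_mulDr.

Definition gr_const (r : R) : groupring R G := << r *g 1%g >>.
Definition gr_elt (g : G) : groupring R G := << 1 *g g >>.

End GroupRing.

Arguments gr_const {R} G r.
Arguments gr_elt R {G} g.

Definition derivation (A : pzRingType) (d : A -> A) : Prop :=
  (forall a b, d (a + b) = d a + d b) /\
  (forall a b, d (a * b) = d a * b + a * d b).

Definition Rderivation (R : pzRingType) (G : groupType)
    (d : groupring R G -> groupring R G) : Prop :=
  derivation d /\ forall r, d (gr_const G r) = 0.

Definition extends (R : pzRingType) (G : groupType) (S : set G)
    (f : S -> groupring R G) (d : groupring R G -> groupring R G) : Prop :=
  forall s : S, d (gr_elt R (val s)) = f s.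

(* fs is an extension f^* of f to F_S obeying the product rule *)
Definition fox_extension (R : pzRingType) (G : groupType) (S : set G)
    (f : S -> groupring R G) (fs : freegroup S -> groupring R G) : Prop :=
  (forall s : S, fs (fg_gen s) = f s) /\
  (forall u v : freegroup S,
     fs (u * v)%g =
       fs u * gr_elt R (can_hom S v) + gr_elt R (can_hom S u) * fs v).

(* Main.v *)
Require Import Defs.
From HB Require Import structures.
From mathcomp Require Import all_boot ssralg classical_sets.
From mathcomp Require Import finmap monalg boolp.

(** The product rule [f^*(uv) = f^*(u) phi(v) + phi(u) f^*(v)] says exactly
    that [w |-> phi(w) + eps f^*(w)] is multiplicative, where [eps] is central
    with [eps^2 = 0].  The elements [g + eps a], with [g] in [G] and [a] in
    [RG], form a group (it is [tangent R G]), so maps on [F_S] obeying the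
    product rule are the same thing as homomorphisms from [F_S] to this group
    that lie over [phi].  The universal property of the free group then gives
    both existence and uniqueness of [f^*] ([fox_extensionP]).

    An [R]-derivation [d] extending [f] yields the map [d \o phi] on [F_S],
    which obeys the product rule and extends [f], hence is [f^*]
    ([Rderivation_fox]).  As [d 1 = 0], the map [f^*] vanishes on every
    relator; and as [phi] is onto, [d] is determined on [G], hence on [RG] by
    linearity ([Rderivation_eq]).

    Conversely, suppose that [f^*] vanishes on [T].  Then [T] lies in the
    kernel of the homomorphism to [tangent R G]; this kernel is normal, so it
    contains the normal closure of [T], which is the whole kernel of [phi].
    Therefore [f^* w] depends on [phi w] only ([fox_extension_factor]), and
    [f^*] descends to a map [D] on [G] with
    [D (gh) = D g * h + g * D h].  Its [R]-linear extension to [RG] is the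
    required derivation ([linext_Rderivation]); commutativity of [R] is what
    makes the coefficients central, so that the product rule passes from [G]
    to [RG]. *)

Set Implicit Arguments.
Unset Strict Implicit.
Unset Printing Implicit Defensive.

Import GRing.Theory.

Local Open Scope ring_scope.

(** * Monomials in the group ring *)

Section Monomials.
Variables (R : pzRingType) (G : groupType).
Implicit Types (a b : groupring R G) (g h : G) (r s : R).

Lemma gr_elt1 : gr_elt R (1%g : G) = 1.
Proof. by []. Qed.

Lemma gr_eltM g h : gr_elt R (g * h)%g = gr_elt R g * gr_elt R h.
Proof. by rewrite [RHS]gr_mulUU mulr1. Qed.

Lemma gr_const0 : gr_const G (0 : R) = 0.
Proof. exact: monalgU0. Qed.

Lemma gr_const1 : gr_const G (1 : R) = 1.
Proof. by []. Qed.

Lemma gr_constD r s : gr_const G (r + s) = gr_const G r + gr_const G s.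
Proof. exact: monalgUD. Qed.

Lemma gr_constM r s : gr_const G (r * s) = gr_const G r * gr_const G s.
Proof. by rewrite [RHS]gr_mulUU mulg1. Qed.

Lemma gr_const_elt r g : gr_const G r * gr_elt R g = << r *g g >>.
Proof. by rewrite [LHS]gr_mulUU mulr1 mul1g. Qed.

Lemma groupring_ind (P : groupring R G -> Prop) :
  P 0 -> (forall a b, P a -> P b -> P (a + b)) ->
  (forall r g, P (gr_const G r * gr_elt R g)) -> forall a, P a.
Proof.
move=> P0 PD PU a; rewrite [a]monalgE.
by apply: big_ind => // g _; rewrite -gr_const_elt; apply: PU.
Qed.

End Monomials.

Lemma gr_const_comm (R : comPzRingType) (G : groupType) (r : R)
    (a : groupring R G) : a * gr_const G r = gr_const G r * a.
Proof.
elim/groupring_ind: a => [|a b IHa IHb|s g]; first by rewrite mul0r mulr0.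
  by rewrite mulrDl mulrDr IHa IHb.
rewrite gr_const_elt [LHS]gr_mulUU [RHS]gr_mulUU.
by rewrite mulrC mulg1 mul1g.
Qed.

Lemma gr_mulZZ (R : comPzRingType) (G : groupType) (r s : R)
    (a b : groupring R G) :
  gr_const G r * a * (gr_const G s * b) = gr_const G (r * s) * (a * b).
Proof. by rewrite gr_constM -!mulrA (mulrA a) gr_const_comm !mulrA. Qed.

(** * The group of dual elements g + eps a *)

(** The pair [(g, a)] stands for [g + eps a] in the dual numbers over [RG];
    being a unit there needs no condition on [a], since [eps a] is nilpotent.
    The alias keeps the twisted law apart from the componentwise one. *)
Definition tangent (R : pzRingType) (G : groupType) : Type :=
  (G * groupring R G)%type.

HB.instance Definition _ R G := Choice.on (tangent R G).

Section TangentGroup.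
Variables (R : pzRingType) (G : groupType).
Implicit Types x y z : tangent R G.

Definition tangent_one : tangent R G := (1%g, 0).

Definition tangent_mul x y : tangent R G :=
  ((x.1 * y.1)%g, x.2 * gr_elt R y.1 + gr_elt R x.1 * y.2).

(** Comes from [(g + eps a)^-1 = g^-1 - eps g^-1 a g^-1]. *)
Definition tangent_inv x : tangent R G :=
  ((x.1^-1)%g, - (gr_elt R (x.1^-1)%g * x.2 * gr_elt R (x.1^-1)%g)).

Lemma tangent_mulA : associative tangent_mul.
Proof.
move=> [g a] [h b] [k c]; rewrite /tangent_mul /= mulgA !gr_eltM.
by rewrite mulrDl mulrDr !mulrA addrA.
Qed.

Lemma tangent_mul1x : left_id tangent_one tangent_mul.
Proof.
by move=> [g a]; rewrite /tangent_mul /= mul1g mul0r add0r gr_elt1 mul1r.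
Qed.

Lemma tangent_mulx1 : right_id tangent_one tangent_mul.
Proof.
by move=> [g a]; rewrite /tangent_mul /= mulg1 mulr0 addr0 gr_elt1 mulr1.
Qed.

Lemma tangent_mulVx : left_inverse tangent_one tangent_inv tangent_mul.
Proof.
move=> [g a]; rewrite /tangent_mul /tangent_inv /= mulVg mulNr -!mulrA.
by rewrite -gr_eltM mulVg gr_elt1 mulr1 addNr.
Qed.

Lemma tangent_mulxV : right_inverse tangent_one tangent_inv tangent_mul.
Proof.
move=> [g a]; rewrite /tangent_mul /tangent_inv /= mulgV mulrN !mulrA.
by rewrite -gr_eltM mulgV gr_elt1 mul1r subrr.
Qed.

HB.instance Definition _ := isGroup.Build (tangent R G)
  tangent_mulA tangent_mul1x tangent_mulx1 tangent_mulVx tangent_mulxV.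

End TangentGroup.

(** * Extensions to the free group *)

Section FoxExtension.
Variables (R : pzRingType) (G : groupType) (S : set G).
Variable f : S -> groupring R G.
Implicit Types (u v w : freegroup S) (fs : freegroup S -> groupring R G).

Definition fox_lift : freegroup S -> tangent R G :=
  fg_lift (fun s : S => (val s, f s) : tangent R G).

(** Both sides are homomorphisms [F_S -> G] with the same values on [S]. *)
Lemma fox_lift1 w : (fox_lift w).1 = can_hom S w.
Proof.
apply: (fg_lift_unique (k := fun v => (fox_lift v).1)) => [u v|s].
  by rewrite /fox_lift fg_liftM.
by rewrite /fox_lift fg_lift_gen.
Qed.

(** A map on [F_S] obeys the product rule if and only if pairing it with [phi]
    gives a homomorphism to [tangent R G], and such a homomorphism is fixed by
    its values on [S]. *)
Lemma fox_extensionP fs :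
  fox_extension f fs <-> fs = (fun w => (fox_lift w).2).
Proof.
split=> [[fsS fsM]|->]; last first.
  split=> [s|u v]; first by rewrite /fox_lift fg_lift_gen.
  by rewrite -!fox_lift1 /fox_lift fg_liftM.
apply/funext => w; pose k v : tangent R G := (can_hom S v, fs v).
suff <- : k w = fox_lift w by [].
apply: fg_lift_unique => [u v|s]; last by rewrite /k /can_hom fg_lift_gen fsS.
by rewrite /k fsM /can_hom fg_liftM.
Qed.

Lemma fox_lift_ker_normal : normal_subgroup [set w | fox_lift w = 1%g].
Proof.
rewrite /fox_lift; split=> /= [|u v Hu Hv|u Hu|u v Hu].
- exact: fg_lift1.
- by rewrite fg_liftM Hu Hv mulg1.
- by rewrite gmulfV /= Hu invg1.
- by rewrite gmulfJ /= Hu conj1g.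
Qed.

(** If [phi u = phi v], then [u^-1 v] is a consequence of the relators, so it
    lies in the normal subgroup [ker (fox_lift f)] as soon as they all do. *)
Lemma fox_extension_factor (T : set (freegroup S)) fs u v :
  presentation S T -> fox_extension f fs -> (forall t, T t -> fs t = 0) ->
  can_hom S u = can_hom S v -> fs u = fs v.
Proof.
move=> [_ kerE] /fox_extensionP-> fsT euv.
have sTK : (normal_closure T `<=` [set w | fox_lift w = 1%g])%classic.
  apply: smallest_sub; first exact: fox_lift_ker_normal.
  move=> t Tt /=; rewrite [fox_lift t]surjective_pairing fsT // fox_lift1.
  suff /= -> : [set w | can_hom S w = 1%g]%classic t by [].
  by rewrite kerE; apply: sub_gen_smallest.
have : (normal_closure T (u^-1 * v)%g).
  by rewrite -kerE /= /can_hom fg_liftM gmulfV /= [fg_lift _ u]euv mulVg.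
move/sTK; rewrite /= /fox_lift fg_liftM gmulfV /= => uv1.
by congr snd; rewrite -[RHS](mulVKg (fox_lift u)) [X in (_ * X)%g]uv1 mulg1.
Qed.

End FoxExtension.

(** * Derivations of the group ring *)

Section Derivations.
Variables (R : pzRingType) (G : groupType).
Implicit Types (a b : groupring R G) (d : groupring R G -> groupring R G).

Lemma Rderivation0 d : Rderivation d -> d 0 = 0.
Proof. by case=> _ d_const; rewrite -[in LHS]gr_const0. Qed.

Lemma Rderivation_eq d d' : Rderivation d -> Rderivation d' ->
  (forall g, d (gr_elt R g) = d' (gr_elt R g)) -> d = d'.
Proof.
move=> Dd Dd' eq_dd'; apply/funext => a.
have [[dD dM] d_const] := Dd; have [[d'D d'M] d'_const] := Dd'.
elim/groupring_ind: a => [|a b IHa IHb|r g]; first by rewrite !Rderivation0.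
  by rewrite dD d'D IHa IHb.
by rewrite dM d'M d_const d'_const eq_dd'.
Qed.

(** Links derivations with the free group: by uniqueness of [f^*], every
    extension [d] of [f] has its values on [G] prescribed by [f^*]. *)
Lemma Rderivation_fox (S : set G) (f : S -> groupring R G) d :
  Rderivation d -> extends f d ->
  fox_extension f (fun w => d (gr_elt R (can_hom S w))).
Proof.
move=> [[_ dM] _] df; split=> [s|u v]; last first.
  by rewrite /can_hom fg_liftM gr_eltM dM.
by rewrite /can_hom fg_lift_gen df.
Qed.

End Derivations.

Section LinearExtension.
Variables (R : comPzRingType) (G : groupType) (D : G -> groupring R G).
Implicit Types (a b : groupring R G) (g h : G).

Definition linext a : groupring R G :=
  \sum_(g <- msupp a) gr_const G a@_g * D g.

Lemma linextEw (X : {fset G}) a : (msupp a `<=` X)%fset ->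
  linext a = \sum_(g <- X) gr_const G a@_g * D g.
Proof.
move=> aX; apply: big_fset_incl => // g _ /mcoeff_outdom ->.
by rewrite gr_const0 mul0r.
Qed.

Lemma linextD a b : linext (a + b) = linext a + linext b.
Proof.
rewrite (linextEw (msuppD_le a b)) (linextEw (fsubsetUl _ (msupp b))).
rewrite (linextEw (fsubsetUr (msupp a) _)) -big_split.
by apply: eq_bigr => g _; rewrite mcoeffD gr_constD mulrDl.
Qed.

Lemma linextU r g : linext (gr_const G r * gr_elt R g) = gr_const G r * D g.
Proof.
by rewrite gr_const_elt (linextEw msuppU_le) big_seq_fset1 mcoeffUU.
Qed.

Lemma linext0 : linext 0 = 0.
Proof. by rewrite /linext msupp0 big_seq_fset0. Qed.

Lemma linext_elt g : linext (gr_elt R g) = D g.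
Proof. by rewrite -[gr_elt R g]mul1r -gr_const1 linextU gr_const1 mul1r. Qed.

(** Both sides of the product rule are biadditive, so monomials suffice. *)
Lemma linext_Rderivation :
  (forall g h, D (g * h)%g = D g * gr_elt R h + gr_elt R g * D h) ->
  Rderivation linext.
Proof.
move=> DM; split; last first.
  have D1 : D 1%g = 0.
    apply: (addrI (D 1%g)); rewrite addr0 -[in RHS](mulg1 1%g) DM.
    by rewrite gr_elt1 mulr1 mul1r.
  by move=> r; rewrite -[gr_const G r]mulr1 -gr_elt1 linextU D1 mulr0.
split=> [|a b]; first exact: linextD.
elim/groupring_ind: a => [|a a' IHa IHa'|r g].
- by rewrite !mul0r linext0 mul0r addr0.
- by rewrite mulrDl !linextD IHa IHa' !mulrDl addrACA.
elim/groupring_ind: b => [|b b' IHb IHb'|s h].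
- by rewrite !mulr0 linext0 mulr0 addr0.
- by rewrite mulrDr !linextD IHb IHb' !mulrDr addrACA.
by rewrite gr_mulZZ -gr_eltM !linextU DM mulrDr !gr_mulZZ.
Qed.

End LinearExtension.

Theorem theorem2p5 (G : groupType) (S : set G) (T : set (freegroup S))
    (R : comPzRingType) (f : S -> groupring R G) :
  presentation S T ->
  [/\ exists! fs : freegroup S -> groupring R G, fox_extension f fs,
      forall fs : freegroup S -> groupring R G, fox_extension f fs ->
        (exists d : groupring R G -> groupring R G,
           Rderivation d /\ extends f d) <->
        (forall t : freegroup S, T t -> fs t = 0)
    & (exists d : groupring R G -> groupring R G,
         Rderivation d /\ extends f d) ->
      exists! d : groupring R G -> groupring R G,
        Rderivation d /\ extends f d].
Proof.
move=> presG; have [phi_onto kerE] := presG; split.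
- exists (fun w => (fox_lift f w).2); split=> [|fs]; first exact/fox_extensionP.
  by move/fox_extensionP.
- move=> fs fsP; split=> [[d [Dd df]] t Tt|fsT].
    have /fox_extensionP dE := Rderivation_fox Dd df.
    move/fox_extensionP: fsP; rewrite -dE => ->.
    have -> : can_hom S t = 1%g.
      suff : [set w | can_hom S w = 1%g]%classic t by [].
      by rewrite kerE; apply: sub_gen_smallest.
    (* [d 1 = 0] because the unit of [RG] is also a constant. *)
    by rewrite -[gr_elt R 1%g]/(gr_const G 1); case: Dd.
  (* The choice of a preimage of [g] is immaterial, by [D_phi]. *)
  pose D g := fs (sval (cid (phi_onto g))).
  have D_phi w : D (can_hom S w) = fs w.
    apply: (fox_extension_factor presG fsP fsT).
    exact: svalP (cid (phi_onto _)).
  have [fsS fsM] := fsP; exists (linext D); split.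
    apply: linext_Rderivation => g h.
    have [[u <-] [v <-]] := (phi_onto g, phi_onto h).
    by rewrite -[(can_hom S u * _)%g]fg_liftM !D_phi fsM.
  move=> s; rewrite linext_elt -fsS -D_phi.
  by rewrite /can_hom fg_lift_gen.
- case=> d [Dd df]; exists d; split=> // d' [Dd' d'f].
  apply: Rderivation_eq => // g; have [w <-] := phi_onto g.
  have /fox_extensionP dE := Rderivation_fox Dd df.
  have /fox_extensionP d'E := Rderivation_fox Dd' d'f.
  by move: dE; rewrite -d'E => /(congr1 (@^~ w)).
Qed.
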